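(* Let $n\ge 0$ and $0\le k\le n-1$. Then for every $0\le m\le n$, $$a_{n,m,k}=\frac{1}{k+1}\binom{n-1}{k}\binom{n}{k}.$$ In particular, the number of $(n,m)$-flawed paths with $k$ double ascents does not depend on $m$.
   Context: A Dyck path of semilength $n\ge 0$ is a lattice path in $\mathbb{Z}\times\mathbb{Z}$ from $(0,0)$ to $(2n,0)$ using up steps $U=(1,1)$ and down steps $D=(1,-1)$; it is allowed to go below the $x$-axis. Write it as a word $P_1P_2\cdots P_{2n}$ over $\{U,D\}$. An up step is under the $x$-axis if it goes from height $-h$ to height $-h+1$ for some $h\ge 1$. A Dyck path is $(n,m)$-flawed if it has semilength $n$ and exactly $m$ up steps under the $x$-axis. A double ascent is a position $i$ with $P_iP_{i+1}=UU$. Let $a_{n,m,k}$ be the number of $(n,m)$-flawed paths with exactly $k$ double ascents. *)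

(* Defs.v *)
From mathcomp Require Import all_boot all_order all_algebra.

Set Implicit Arguments.
Unset Strict Implicit.
Unset Printing Implicit Defensive.

Import GRing.Theory.
Local Open Scope ring_scope.

(* A path is encoded by its word of steps: [true] is the up step (1, 1) and
   [false] is the down step (1, -1).  Positions are numbered from 0, so the
   i-th letter (i < size w) goes from [height w i] to [height w i.+1]. *)
Definition step := bool.
Definition U : step := true.
Definition D : step := false.

Definition step_height (s : step) : int := if s == U then 1 else - 1.

Definition height (w : seq step) (i : nat) : int :=
  \sum_(s <- take i w) step_height s.

(* The path may go below the x-axis. *)
Definition dyck_path (n : nat) (w : seq step) : bool :=
  (size w == n.*2) && (height w n.*2 == 0).

(* The up step at position i starts at height -h for some h >= 1. *)
Definition up_under_axis (w : seq step) (i : nat) : bool :=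
  (nth D w i == U) && (height w i < 0).

Definition flaws (w : seq step) : nat :=
  count (up_under_axis w) (iota 0 (size w)).

Definition flawed_path (n m : nat) (w : seq step) : bool :=
  dyck_path n w && (flaws w == m).

(* The default letter of [nth] is D, so the last position is never a double
   ascent. *)
Definition double_ascent (w : seq step) (i : nat) : bool :=
  (nth D w i == U) && (nth D w i.+1 == U).

Definition double_ascents (w : seq step) : nat :=
  count (double_ascent w) (iota 0 (size w)).

Definition num_flawed_paths (n m k : nat) : nat :=
  #|[set w : (n.*2).-tuple step | flawed_path n m w & double_ascents w == k]|.

(* Main.v *)
(* Append a final D to a path and close the word of length 2n + 1 up into a
   circle: the cyclic double ascents are invariant under rotation.  A circular
   word can be reopened after each of its n + 1 letters D, and the number of
   flaws of the path obtained is the rank of the cut among all the cuts, ordered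
   by height and then by position.  So each m in 0..n is realised by exactly one
   cut, and a double count of (circular word, cut) gives the same number of paths
   for every m, namely 1/(n+1) of the number C(n-1,k) C(n+1,k+1) of all paths
   with k double ascents. *)

Require Import Defs.
From mathcomp Require Import all_boot all_order all_algebra zify ring.

Set Implicit Arguments.
Unset Strict Implicit.
Unset Printing Implicit Defensive.

Import Order.TTheory GRing.Theory Num.Theory.
Local Open Scope ring_scope.

(** * Ranks in a finite total order *)

(** The rank is injective on [A] and takes values in 1..#|A|, so by pigeonhole it takes each value
    once. An element counts itself in its rank, whence [m.+1]. *)
Lemma card_rank_eq (T : finType) (A : {set T}) (r : rel T) (m : nat) :
    total r -> transitive r -> antisymmetric r -> (m < #|A|)%N ->
  #|[set p in A | #|[set q in A | r q p]| == m.+1]| = 1%N.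
Proof.
move=> r_total r_trans r_anti lt_mA.
pose rank p := #|[set q in A | r q p]|.
have rank_inj : {in A &, injective rank}.
  have main p p' : p \in A -> p' \in A -> r p p' -> rank p = rank p' -> p = p'.
    move=> Ap Ap' rpp' eq_rank.
    have sub : [set q in A | r q p] \subset [set q in A | r q p'].
      apply/subsetP=> q; rewrite !inE => /andP[-> rqp].
      exact: r_trans rqp rpp'.
    have /setP/(_ p') : [set q in A | r q p] = [set q in A | r q p'].
      by apply/eqP; rewrite eqEcard sub /= (eq_leq (esym eq_rank)).
    have rp'p' : r p' p' by case/orP: (r_total p' p').
    rewrite !inE Ap' rp'p' => /= rp'p.
    by apply: r_anti; rewrite rpp' rp'p.
  move=> p p' Ap Ap' eq_rank.
  by case/orP: (r_total p p') => ?; [|symmetry]; apply: main.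
have rank_uniq : uniq [seq rank p | p <- enum A].
  rewrite map_inj_in_uniq ?enum_uniq // => p p'; rewrite !mem_enum.
  exact: rank_inj.
have rank_range : {subset [seq rank p | p <- enum A] <= iota 1 #|A|}.
  move=> _ /mapP[p Ap ->]; move: Ap; rewrite mem_enum mem_iota add1n ltnS => Ap.
  apply/andP; split; last by apply/subset_leq_card/subsetP=> q; rewrite inE => /andP[].
  by apply/card_gt0P; exists p; rewrite inE Ap; case/orP: (r_total p p).
have [_ rank_surj] := uniq_min_size rank_uniq rank_range
  (eq_leq (etrans (size_iota _ _) (etrans (cardE _) (esym (size_map _ _))))).
have /mapP[p] : m.+1 \in [seq rank p | p <- enum A].
  by rewrite rank_surj mem_iota add1n !ltnS lt_mA.
rewrite mem_enum => Ap rank_p; rewrite -(cards1 p); congr #|pred_of_set _|.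
apply/setP=> q; rewrite !inE rank_p.
apply/andP/eqP => [[Aq /eqP/rank_inj -> //] | ->]; by rewrite ?eqxx.
Qed.

(** * Heights, flaws and low downs *)

Lemma height_rcons (w : seq step) (x : step) (i : nat) :
  (i <= size w)%N -> height (rcons w x) i = height w i.
Proof. by move=> le_i; rewrite /height -cats1 takel_cat. Qed.

Lemma height_oversize (w : seq step) (i : nat) :
  (size w <= i)%N -> height w i = \sum_(s <- w) step_height s.
Proof. by move=> le_i; rewrite /height take_oversize. Qed.

Lemma sum_step_height (w : seq step) :
  \sum_(s <- w) step_height s = (count id w)%:Z *+ 2 - (size w)%:Z.
Proof.
elim: w => [|x w IHw]; first by rewrite big_nil.
by rewrite big_cons IHw /step_height /U; case: x => /=; lia.
Qed.

(* Where the total height is 0, there are as many low downs as flaws; unlike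
   the flaws, they sit on the letters at which the circular word is cut. *)
Definition low_downs (w : seq step) : nat :=
  (\sum_(0 <= i < size w) (~~ nth D w i && (height w i.+1 < 0)%R))%N.

(** When letters are appended one by one, the negative part of the height rises by 1 exactly at a
    flaw and falls by 1 exactly at a low down. *)
Lemma flaws_low_downs (w : seq step) :
  (flaws w)%:Z - (low_downs w)%:Z = Num.min 0 (\sum_(s <- w) step_height s).
Proof.
elim/last_ind: w => [|w x IHw].
  by rewrite /flaws /low_downs /= !big_nil minxx.
have -> : flaws (rcons w x) =
    (flaws w + (x && ((\sum_(s <- w) step_height s) < 0)%R))%N.
  rewrite /flaws size_rcons -addn1 iotaD count_cat add0n /= addn0.
  congr (_ + _)%N.
    apply: eq_in_count => i; rewrite mem_iota /up_under_axis /= => lt_i.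
    by rewrite nth_rcons lt_i height_rcons // ltnW.
  rewrite /up_under_axis nth_rcons ltnn eqxx height_rcons // height_oversize //.
  by case: x.
have -> : low_downs (rcons w x) =
    (low_downs w + (~~ x && ((\sum_(s <- rcons w x) step_height s) < 0)%R))%N.
  rewrite /low_downs size_rcons big_nat_recr //=.
  congr (_ + _)%N; last by rewrite nth_rcons ltnn eqxx height_oversize // size_rcons.
  apply: eq_big_nat => i /andP[_ lt_i].
  by rewrite nth_rcons lt_i height_rcons.
rewrite -cats1 big_cat big_seq1 /=.
move: IHw; set h := \sum_(s <- w) _; rewrite /step_height /U.
by case: x => /=; lia.
Qed.

(** The closing D goes from height 0 to -1: it adds one low down and no flaw. *)
Lemma low_downs_rcons (w : seq step) :
  \sum_(s <- w) step_height s = 0 -> low_downs (rcons w D) = (flaws w).+1.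
Proof.
move=> h0; have := flaws_low_downs w; have := flaws_low_downs (rcons w D).
suff -> : flaws (rcons w D) = flaws w.
  by rewrite -cats1 big_cat big_seq1 /= h0 /step_height /=; lia.
rewrite /flaws size_rcons -addn1 iotaD count_cat add0n /= addn0.
rewrite /up_under_axis nth_rcons ltnn eqxx /= addn0.
apply: eq_in_count => i; rewrite mem_iota /= => lt_i.
by rewrite nth_rcons lt_i height_rcons // ltnW.
Qed.

(** Cut [p] is made just after letter [p], hence the successors in the heights. *)
Definition cut_le (v : seq step) (q p : nat) : bool :=
  (height v q.+1 < height v p.+1) ||
  (height v q.+1 == height v p.+1) && (q <= p)%N.

(* Heights measured from the cut are [height v q.+1 - height v p.+1] for the
   letters q > p, and one less for the letters q <= p, which come after the
   wrap-around; negativity is then exactly [cut_le v q p]. *)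
Lemma low_downs_rot (v : seq step) (p : nat) :
    (p < size v)%N -> \sum_(s <- v) step_height s = -1 ->
  low_downs (rot p.+1 v) =
    (\sum_(0 <= q < size v) (~~ nth D v q && cut_le v q p))%N.
Proof.
move=> lt_p hv; set a := take p.+1 v; set b := drop p.+1 v.
have size_a : size a = p.+1 by rewrite size_takel.
have vE : v = a ++ b by rewrite cat_take_drop.
have hp : height v p.+1 = \sum_(s <- a) step_height s by [].
have hab : \sum_(s <- a) step_height s + \sum_(s <- b) step_height s = -1.
  by rewrite -hv [in RHS]vE big_cat.
rewrite /low_downs /rot -/a -/b; clearbody a b; rewrite size_cat addnC -size_cat -vE.
have le_b : (size b <= size v)%N by rewrite vE size_cat leq_addl.
rewrite (big_cat_nat (n := size b)) //=.
rewrite [RHS](big_cat_nat (n := p.+1)) //= addnC; congr (_ + _)%N.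
  rewrite {1}vE size_cat -{1}[size b]add0n big_addn addnK size_a.
  apply: eq_big_nat => q /andP[_ lt_q].
  rewrite nth_cat addnC ltnNge leq_addr /= addKn.
  rewrite {1}vE nth_cat size_a lt_q; congr (nat_of_bool (_ && _)).
  rewrite /cut_le hp.
  have -> : height (b ++ a) (size b + q).+1 =
      \sum_(s <- b) step_height s + height a q.+1.
    by rewrite /height -addnS takeD take_size_cat // drop_size_cat // big_cat.
  have -> : height v q.+1 = height a q.+1.
    by rewrite /height vE takel_cat // size_a.
  (* The total height -1 turns the strict inequality into a weak one, which admits the ties with
     [q <= p]. *)
  by move: hab; lia.
rewrite -{1}[p.+1]add0n big_addn.
have -> : (size v - p.+1)%N = size b by rewrite vE size_cat size_a addKn.
apply: eq_big_nat => q /andP[_ lt_q].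
rewrite nth_cat lt_q {1}vE nth_cat size_a ltnNge leq_addl /= addnK.
congr (nat_of_bool (_ && _)); rewrite /cut_le hp.
have -> : height (b ++ a) q.+1 = height b q.+1 by rewrite /height takel_cat.
have -> : height v (q + p.+1).+1 = \sum_(s <- a) step_height s + height b q.+1.
  by rewrite /height {1}vE addnC -addnS takeD take_cat size_a ltnn subnn take0 cats0
     drop_size_cat // big_cat.
by lia.
Qed.

(** * Cyclic double ascents *)

Definition cyclic_ascents (v : seq step) : nat :=
  count (fun xy => xy.1 && xy.2) (zip v (rot 1 v)).

(** Rotations commute, so both zipped words turn together and the pairs are only permuted. *)
Lemma cyclic_ascents_rot (v : seq step) (j : nat) :
  cyclic_ascents (rot j v) = cyclic_ascents v.
Proof.
rewrite /cyclic_ascents rot_rot [in LHS]/rot -/(rot 1 v).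
have size_r : size (rot 1 v) = size v by rewrite size_rot.
rewrite zip_cat ?size_drop ?size_r // count_cat addnC -count_cat.
by rewrite -zip_cat ?size_take ?size_r // !cat_take_drop.
Qed.

Lemma double_ascents_cons (x : step) (w : seq step) :
  double_ascents (x :: w) = ((x && head D w) + double_ascents w)%N.
Proof.
rewrite /double_ascents /= -[1%N]addn0 iotaDl count_map /double_ascent /=.
by rewrite -nth0 !eqb_id.
Qed.

Lemma cyclic_ascents_rcons (w : seq step) :
  cyclic_ascents (rcons w D) = double_ascents w.
Proof.
(* The wrapped-around letter is paired with the final D, so it may be any [y]; this frees the
   induction from the first letter. *)
have main y : count (fun xy => xy.1 && xy.2)
    (zip (rcons w D) (rcons (behead (rcons w D)) y)) = double_ascents w.
  elim: w => [|x w IHw] //=; rewrite double_ascents_cons -IHw.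
  by case: w {IHw}.
by case: w main => [|x w] main; rewrite /cyclic_ascents /= ?rot1_cons ?main.
Qed.

Lemma nth_rotS (v : seq step) (p : nat) :
  (p < size v)%N -> last U (rot p.+1 v) = nth D v p.
Proof.
by move=> lt_p; rewrite /rot (take_nth D lt_p) last_cat last_rcons.
Qed.

(** * Double counting of circular words and cuts *)

(** For a fixed position [p], rotation by [p.+1] permutes [V] and brings letter [p] to the end, so
    all [L] positions contribute equally. *)
Lemma sum_card_cuts (L : nat) (V : {set L.-tuple step}) (Q : pred (seq step)) :
    (forall (j : nat) (v : L.-tuple step),
       ([tuple of rot j v] \in V) = (v \in V)) ->
  (\sum_(v in V) #|[set p : 'I_L | ~~ nth D v p & Q (rot p.+1 v)]| =
     L * #|[set v in V | ~~ last U v & Q v]|)%N.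
Proof.
move=> V_rot; under eq_bigr => v _ do rewrite -sum1_card big_mkcond.
transitivity (\sum_(p < L) #|[set v in V | ~~ last U v & Q v]|)%N; last first.
  by rewrite sum_nat_const card_ord.
rewrite exchange_big /=.
apply: eq_bigr => p _.
have rot_inj_tuple : injective (fun v : L.-tuple step => [tuple of rot p.+1 v]).
  by move=> v w /(congr1 val)/rot_inj/val_inj.
rewrite -big_mkcondr -sum1_card [RHS](reindex_inj rot_inj_tuple).
apply: eq_bigl => v; rewrite !inE V_rot /= nth_rotS //.
by rewrite size_tuple.
Qed.

Lemma dyck_path_count (n : nat) (w : (n.*2).-tuple step) :
  dyck_path n w = (count id w == n).
Proof.
rewrite /dyck_path size_tuple eqxx height_oversize ?size_tuple //.
by rewrite sum_step_height size_tuple; lia.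
Qed.

(** Circular words keep a marked starting point, so that no orbit sizes enter the count. *)
Definition cyclic_words (n k : nat) : {set (n.*2).+1.-tuple step} :=
  [set v : (n.*2).+1.-tuple step | count id v == n & cyclic_ascents v == k].

Lemma card_last_down (n k : nat) (Q : pred (seq step)) :
  #|[set v in cyclic_words n k | ~~ last U v & Q v]| =
  #|[set w : (n.*2).-tuple step |
       [&& count id w == n, double_ascents w == k & Q (rcons w D)]]|.
Proof.
pose f (w : (n.*2).-tuple step) := [tuple of rcons w D].
have f_inj : injective f by move=> w1 w2 /(congr1 val)/rcons_inj[]/val_inj.
rewrite -(card_imset _ f_inj); congr #|pred_of_set _|.
apply/setP=> v; rewrite !inE.
apply/idP/imsetP => [|[w]]; last first.
  rewrite inE => /and3P[cw aw Qw] ->.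
  rewrite /f /= cyclic_ascents_rcons last_rcons aw Qw -cats1 count_cat /=.
  by rewrite !addn0 cw.
case: v => s; case/lastP: s => // s x sz /=; rewrite last_rcons.
case: x sz => /= sz; first by rewrite andbF.
case/andP=> [/andP[cs as_k] Qs].
have sz' : size s == n.*2 by rewrite size_rcons eqSS in sz.
exists (Tuple sz'); last exact: val_inj.
rewrite inE /= -cyclic_ascents_rcons as_k Qs !andbT.
by move: cs; rewrite -cats1 count_cat /= !addn0.
Qed.

Lemma cyclic_words_rot (n k j : nat) (v : (n.*2).+1.-tuple step) :
  ([tuple of rot j v] \in cyclic_words n k) = (v \in cyclic_words n k).
Proof.
by rewrite !inE /= cyclic_ascents_rot (permP (introT permPl (perm_rot j v))).
Qed.

Lemma card_downs (n k : nat) (v : (n.*2).+1.-tuple step) :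
  v \in cyclic_words n k -> #|[set p : 'I_(n.*2).+1 | ~~ nth D v p]| = n.+1.
Proof.
rewrite inE => /andP[/eqP cv _].
have -> : #|[set p : 'I_(n.*2).+1 | ~~ nth D v p]| = count (predC id) v.
  rewrite -sum1_count big_tuple -sum1dep_card.
  by apply: eq_bigl => i; rewrite (tnth_nth D).
by have := count_predC id v; rewrite size_tuple cv; lia.
Qed.

Lemma card_cyclic_words (n m k : nat) : (m <= n)%N ->
  #|cyclic_words n k| = ((n.*2).+1 * num_flawed_paths n m k)%N.
Proof.
move=> le_mn.
transitivity ((n.*2).+1 *
    #|[set v in cyclic_words n k | ~~ last U v & low_downs v == m.+1]|)%N.
  rewrite -(sum_card_cuts (fun s => low_downs s == m.+1)); last first.
    by move=> j v; apply: cyclic_words_rot.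
  rewrite -sum1_card; apply: eq_bigr => v Vv.
  have hv : \sum_(s <- v) step_height s = -1.
    move: (Vv); rewrite inE => /andP[/eqP cv _].
    by rewrite sum_step_height size_tuple cv; lia.
  have lt_m : (m < #|[set p : 'I_(n.*2).+1 | ~~ nth D v p]|)%N.
    by rewrite (card_downs Vv).
  (* The low downs of the word reopened at [p] number the rank of [p] among the D's, so exactly one
     cut gives [m.+1]. *)
  rewrite -(@card_rank_eq _ _ (fun q p : 'I_(n.*2).+1 => cut_le v q p) m _ _ _ lt_m).
  - congr #|pred_of_set _|; apply/setP=> p; rewrite !inE; congr (_ && (_ == _)).
    rewrite low_downs_rot ?size_tuple // big_mkord -sum1dep_card.
    by rewrite [LHS]big_mkcond; apply: eq_bigr => q _; rewrite inE; case: ifP.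
  - by move=> q p; rewrite /cut_le; lia.
  - by move=> q p r; rewrite /cut_le; lia.
  - by move=> q p; rewrite /cut_le => qp; apply: val_inj => /=; lia.
rewrite (card_last_down n k (fun s => low_downs s == m.+1)); congr (_ * _)%N.
congr #|pred_of_set _|; apply/setP=> w; rewrite !inE /flawed_path dyck_path_count.
case: (eqVneq (count id w) n) => //= cw; rewrite andbC.
rewrite low_downs_rcons //.
by rewrite sum_step_height size_tuple cw; lia.
Qed.

(** * Counting words by double ascents *)

Lemma card_tuple_cons (l : nat) (P : pred (seq bool)) :
  #|[set w : l.+1.-tuple bool | P w]| =
  (#|[set w : l.-tuple bool | P (true :: w)]|
   + #|[set w : l.-tuple bool | P (false :: w)]|)%N.
Proof.
rewrite -!sum1dep_card.
pose f (p : bool * l.-tuple bool) := [tuple of p.1 :: p.2].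
have f_bij : bijective f.
  exists (fun w => (thead w, [tuple of behead w])) => [[b w]|w].
    by rewrite /f /= theadE; congr (_, _); apply: val_inj.
  by rewrite /f /=; case/tupleP: w => b w; apply: val_inj.
rewrite (reindex f) /=; last exact: onW_bij.
rewrite -(pair_big_dep xpredT (fun b (w : l.-tuple bool) => P (b :: w))
  (fun _ _ => 1%N)) /=.
by rewrite big_bool.
Qed.

Lemma card_tuple_pred0 (l : nat) (P : pred (seq bool)) :
  (forall w : l.-tuple bool, ~~ P w) -> #|[set w : l.-tuple bool | P w]| = 0%N.
Proof.
by move=> nP; apply: eq_card0 => w; rewrite inE; apply/negbTE.
Qed.

Lemma card_tuple0 (P : pred (seq bool)) :
  #|[set w : 0.-tuple bool | P w]| = P [::].
Proof.
rewrite -sum1dep_card big_mkcond (big_pred1 [tuple]) => [|w].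
  by case: (P [::]).
by apply/esym/eqP; apply: tuple0.
Qed.

Definition num_words (l u k : nat) : nat :=
  #|[set w : l.-tuple step | (count id w == u) && (double_ascents w == k)]|.

(** The leading U counts neither in [l] nor in [u]; it only affects the double ascents. *)
Definition num_words_after_U (l u k : nat) : nat :=
  #|[set w : l.-tuple step |
       (count id w == u) && (double_ascents (U :: w) == k)]|.

Lemma num_words_small (l u k : nat) : (l < u)%N -> num_words l u k = 0%N.
Proof.
move=> lt_lu; apply: (@card_tuple_pred0 _
  (fun w => (count id w == u) && (double_ascents w == k))) => w.
have := count_size id w; rewrite size_tuple => le_l.
by rewrite (ltn_eqF (leq_ltn_trans le_l lt_lu)).
Qed.

Lemma num_words_S (l u k : nat) :
  num_words l.+1 u k =
    ((if u is u'.+1 then num_words_after_U l u' k else 0) + num_words l u k)%N.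
Proof.
rewrite /num_words (@card_tuple_cons l
  (fun w => (count id w == u) && (double_ascents w == k))).
congr (_ + _)%N; last first.
  by apply: eq_card => w; rewrite !inE double_ascents_cons.
case: u => [|u]; last by apply: eq_card => w; rewrite !inE.
by apply: (@card_tuple_pred0 _ (fun w => (count id (true :: w) == 0%N) &&
  (double_ascents (true :: w) == k))) => w.
Qed.

Lemma num_words_after_U_S (l u k : nat) :
  num_words_after_U l.+1 u k =
    ((if (u, k) is (u'.+1, k'.+1) then num_words_after_U l u' k' else 0) +
     num_words l u k)%N.
Proof.
rewrite /num_words_after_U (@card_tuple_cons l
  (fun w => (count id w == u) && (double_ascents (U :: w) == k))).
congr (_ + _)%N; last first.
  by apply: eq_card => w; rewrite !inE !double_ascents_cons.
case: u k => [|u] [|k]; last first.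
  by apply: eq_card => w; rewrite !inE (double_ascents_cons U (true :: w)).
all: apply: (@card_tuple_pred0 _ (fun w => (count id (true :: w) == _) &&
  (double_ascents [:: U, true & w] == _))) => w //.
by rewrite (double_ascents_cons U (true :: w)) andbF.
Qed.

(* A word with u letters U, k double ascents and d letters D has u - k runs of
   U's, placed in u - k of the d + 1 gaps between the D's; after an initial U
   the first gap is always occupied. *)
Lemma num_wordsE (l u d k : nat) : l = (u + d)%N ->
  num_words l u k = ('C(u.-1, k) * 'C(d.+1, u - k))%N /\
  num_words_after_U l u k = ('C(u, k) * 'C(d, u - k))%N.
Proof.
elim: l u d k => [|l IHl] u d k.
  move=> /esym/eqP; rewrite addn_eq0 => /andP[/eqP-> /eqP->].
  rewrite /num_words /num_words_after_U.
  rewrite (card_tuple0 (fun w => (count id w == 0%N) && (double_ascents w == k))).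
  rewrite (card_tuple0
    (fun w => (count id w == 0%N) && (double_ascents (U :: w) == k))).
  by rewrite sub0n !bin0 !muln1; case: k.
rewrite num_words_S num_words_after_U_S.
case: u => [|u] lE.
  have [-> _] := IHl 0%N l k (esym (add0n l)).
  by rewrite !sub0n !bin0.
have {}lE : l = (u + d)%N by lia.
have IHu j : num_words_after_U l u j = ('C(u, j) * 'C(d, u - j))%N.
  by case: (IHl u d j lE).
have IHd j : num_words l u.+1 j = ('C(u, j) * 'C(d, u.+1 - j))%N.
  (* For [d = 0] the letters U exceed the length, and the product vanishes too. *)
  case: d lE {IHu} => [|d] lE.
    rewrite num_words_small; last by lia.
    have [le_ju | lt_uj] := leqP j u; last by rewrite bin_small.
    by rewrite subSn // bin0n muln0.
  by case: (IHl u.+1 d j); first by lia.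
(* Pascal's rule applies to the second factor in the first count, and to the first factor in the
   second. *)
split.
  rewrite IHu IHd -mulnDr; have [le_ku | lt_uk] := leqP k u.
    by rewrite subSn // [in RHS]binS addnC.
  by rewrite /= (bin_small lt_uk).
case: k => [|k]; first by rewrite IHd !bin0.
by rewrite IHu IHd subSS -mulnDl addnC -binS.
Qed.

Theorem theorem4p2 (n k : nat) (hk : (k < n)%N) :
  (forall m : nat, (m <= n)%N ->
     (num_flawed_paths n m k)%:R
       = (k.+1%:R)^-1 * ('C(n.-1, k))%:R * ('C(n, k))%:R :> rat) /\
  (forall m1 m2 : nat, (m1 <= n)%N -> (m2 <= n)%N ->
     num_flawed_paths n m1 k = num_flawed_paths n m2 k).
Proof.
(* The double count with no condition on the cut: each circular word has [n.+1] cuts. *)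
have total : (n.+1 * #|cyclic_words n k| =
    (n.*2).+1 * ('C(n.-1, k) * 'C(n.+1, k.+1)))%N.
  have -> : 'C(n.+1, k.+1) = 'C(n.+1, n - k) by rewrite -bin_sub ?subSS // ltnS ltnW.
  have [<- _] := num_wordsE k (esym (addnn n)).
  have := sum_card_cuts predT (@cyclic_words_rot n k).
  rewrite card_last_down; under eq_bigr => v Vv.
    under eq_finset => p do rewrite andbT.
    rewrite (card_downs Vv); over.
  rewrite sum_nat_const mulnC => ->; congr (_ * #|pred_of_set _|)%N.
  by apply/setP=> w; rewrite !inE andbT.
have num_eq m : (m <= n)%N ->
    (k.+1 * num_flawed_paths n m k = 'C(n.-1, k) * 'C(n, k))%N.
  move=> /card_cyclic_words-/(_ k) card_m; apply/eqP.
  rewrite -(eqn_pmul2l (ltn0Sn n)) -(eqn_pmul2l (ltn0Sn n.*2)); apply/eqP.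
  (* Absorption, (n+1) C(n,k) = (k+1) C(n+1,k+1), trades the factor 1/(n+1) for 1/(k+1). *)
  have := mul_bin_diag n.+1 k; rewrite /= => diag.
  move: total; rewrite card_m => total.
  transitivity (k.+1 * (n.+1 * (n.*2.+1 * num_flawed_paths n m k)))%N; first by ring.
  rewrite total.
  transitivity (n.*2.+1 * ('C(n.-1, k) * (k.+1 * 'C(n.+1, k.+1))))%N; first by ring.
  by rewrite -diag; ring.
split=> [m /num_eq eq_m | m1 m2 /num_eq eq1 /num_eq eq2].
  rewrite -mulrA -natrM -eq_m natrM mulKf //.
  by rewrite pnatr_eq0.
by apply/eqP; rewrite -(eqn_pmul2l (ltn0Sn k)) eq1 eq2.
Qed.
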